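(* Let $\Omega\subset\mathbb{R}^3$ be a bounded domain with $\partial\Omega\in C^{1,\alpha}$, $0<\alpha\le1$. Then $$\sup_{M\in\mathbb{R}^3}\int_{\partial\Omega}\frac{|\mathbf r_{MP}\cdot n_P|}{r_{MP}^3}\,dS_P<+\infty .$$
   Context: $\mathbf r_{MP}=\overrightarrow{MP}$, $r_{MP}=|M-P|$, $n_P$ is the exterior unit normal vector to $\partial\Omega$ at $P$, and $dS_P$ is the surface measure on $\partial\Omega$. $\partial\Omega\in C^{1,\alpha}$ means: each point of $\partial\Omega$ has a neighbourhood in which $\partial\Omega$ is the graph of a $C^{1,\alpha}$ function of two of the three coordinates, with $\Omega$ locally on exactly one side of the graph. *)

(* Defs.v *)
From HB Require Import structures.
From mathcomp Require Import all_boot all_order all_algebra.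
From mathcomp Require Import all_classical all_reals all_analysis.
From mathcomp Require Import finmap lra measurable_realfun.

Set Implicit Arguments.
Unset Strict Implicit.
Unset Printing Implicit Defensive.

Import Order.TTheory GRing.Theory Num.Theory.
Import numFieldNormedType.Exports.

Local Open Scope classical_set_scope.
Local Open Scope ring_scope.

(* The library norm of 'rV[R]_3 is the sup norm; the Euclidean one is enorm
   below.  Both give the same topology, hence the same Borel sets. *)
Notation borel3 R := (g_sigma_algebraType (@open 'rV[R]_3)).

Section Geometry.
Context {R : realType}.
Local Notation R3 := 'rV[R]_3.
Local Notation R2 := (R * R)%type.
Implicit Types (Omega : set R3) (P v w : R3) (u : R2) (alpha : R).

Definition dot v w : R := \sum_(i < 3) v 0 i * w 0 i.

Definition enorm v : R := Num.sqrt (dot v v).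

Definition frontier Omega : set R3 := closure Omega `\` interior Omega.

Definition bounded_domain Omega : Prop :=
  [/\ Omega !=set0, open Omega, connected Omega & bounded_set Omega].

Definition partial (k : 'I_2) (phi : R2 -> R) u : R :=
  'D_(if k == 0 then (1, 0) else (0, 1)) phi u.

Definition C1_holder alpha (D : set R2) (phi : R2 -> R) : Prop :=
  (forall u, D u -> differentiable phi u) /\
  exists C : R, forall (k : 'I_2) (u1 u2 : R2), D u1 -> D u2 ->
    `|partial k phi u1 - partial k phi u2| <= C * `|u1 - u2| `^ alpha.

(* A candidate local description of a surface: inside the neighbourhood
   [nbhd], the coordinate number [axis] is the function [height] of the two
   others, taken in increasing order.  The flag [above] tells that the domain
   is locally above the graph rather than below it. *)
Record graph_chart := GraphChart {
  nbhd : set R3;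
  axis : 'I_3;
  above : bool;
  base : set R2;
  height : R2 -> R }.

Definition shadow (c : graph_chart) P : R2 :=
  (P 0 (lift (axis c) (0 : 'I_2)), P 0 (lift (axis c) (1 : 'I_2))).

(* The point of 'rV_3 whose [axis] coordinate is z and whose two other
   coordinates are a 0 and a 1. *)
Definition insert_axis (c : graph_chart) (z : R) (a : 'I_2 -> R) : R3 :=
  \row_j (if unlift (axis c) j is Some k then a k else z).

Definition graph_point (c : graph_chart) u : R3 :=
  insert_axis c (height c u) (fun k => if k == 0 then u.1 else u.2).

Definition area_density (c : graph_chart) u : R :=
  Num.sqrt (1 + \sum_(k < 2) partial k (height c) u ^+ 2).

Definition is_graph_chart alpha Omega (c : graph_chart) : Prop :=
  [/\ open (nbhd c), open (base c), C1_holder alpha (base c) (height c),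
      (forall P, nbhd c P -> base c (shadow c P)) &
      forall P, nbhd c P ->
        (frontier Omega P <-> P 0 (axis c) = height c (shadow c P)) /\
        (Omega P <-> if above c then height c (shadow c P) < P 0 (axis c)
                     else P 0 (axis c) < height c (shadow c P))].

Definition C1_holder_boundary alpha Omega : Prop :=
  forall P, frontier Omega P ->
    exists2 c, is_graph_chart alpha Omega c & nbhd c P.

(* (- grad height, 1) is normal to the graph and points upwards, that is out
   of the domain when the domain lies below the graph. *)
Definition chart_normal (c : graph_chart) u : R3 :=
  ((-1) ^+ above c / area_density c u) *:
    insert_axis c 1 (fun k => - partial k (height c) u).

Definition is_exterior_normal alpha Omega P v : Prop :=
  exists c, [/\ is_graph_chart alpha Omega c, nbhd c P &
                v = chart_normal c (shadow c P)].

(* The value does not depend on the chart; it is junk (0) when there is none,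
   in particular outside the boundary. *)
Definition exterior_normal alpha Omega P : R3 :=
  xget 0 [set v | frontier Omega P /\ is_exterior_normal alpha Omega P v].

(* dS = sqrt (1 + |grad height|^2) du, for A contained in
   nbhd c `&` frontier Omega; the projection of A is then
   graph_point c @^-1` A. *)
Definition graph_area (c : graph_chart) (A : set R3) : \bar R :=
  (\int[lebesgue_measure \x lebesgue_measure]_(u in graph_point c @^-1` A)
     (area_density c u)%:E)%E.

(* Surface measure: cut the boundary into finitely many disjoint Borel
   pieces, each one inside a chart, and add up the graph areas.  The result
   is independent of the cutting (change of variables), so such a sigma is
   unique; it exists by surface_measure_exists below. *)
Definition is_surface_measure alpha Omega
    (sigma : {measure set (borel3 R) -> \bar R}) : Prop :=
  exists n (c : 'I_n -> graph_chart) (E : 'I_n -> set (borel3 R)),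
    [/\ (forall k, is_graph_chart alpha Omega (c k)),
        (forall k, measurable (E k) /\ E k `<=` nbhd (c k)),
        trivIset [set: 'I_n] E,
        \bigcup_k E k = frontier Omega &
        forall A : set (borel3 R), measurable A ->
          sigma A = (\sum_(k < n) graph_area (c k) (A `&` E k))%E].

End Geometry.

Lemma open2_measurable (R : realType) (O : set (R * R)) : open O -> measurable O.
Proof.
move=> oO.
pose box (q : rat * rat * (rat * rat)) : set (R * R) :=
  `]ratr q.1.1, ratr q.1.2[%classic `*` `]ratr q.2.1, ratr q.2.2[%classic.
have -> : O = \bigcup_q (if `[< box q `<=` O >] then box q else set0).
  apply/seteqP; split => [u Ou|u [q _]]; last by case: asboolP => // h /h.
  have /nbhs_ballP[e /= e0 he] := open_nbhs_nbhs (conj oO Ou).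
  have [a1 +] := rat_in_itvoo (ltac:(lra) : u.1 - e < u.1).
  have [b1 +] := rat_in_itvoo (ltac:(lra) : u.1 < u.1 + e).
  have [a2 +] := rat_in_itvoo (ltac:(lra) : u.2 - e < u.2).
  have [b2 +] := rat_in_itvoo (ltac:(lra) : u.2 < u.2 + e).
  rewrite !in_itv/= => /andP[? ?] /andP[? ?] /andP[? ?] /andP[? ?].
  exists ((a1, b1), (a2, b2)) => //.
  rewrite asboolT; first by split; rewrite /= in_itv/=; apply/andP.
  move=> w [/=]; rewrite !in_itv/= => /andP[? ?] /andP[? ?]; apply: he.
  split; rewrite /ball/= /ball_/= ltr_norml; apply/andP; split; lra.
apply: countable_bigcupT_measurable => // q; case: ifP => // _.
by apply: measurableX; exact: measurable_itv.
Qed.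

Lemma cont2_measurable (R : realType) (D : set (R * R)) (f : R * R -> R) :
  open D -> (forall u, D u -> {for u, continuous f}) -> measurable_fun D f.
Proof.
move=> oD cf; apply: (measurability _ (RGenOpens.measurableE R)).
move=> _ [_ [a [b ->] <-]]; apply: open2_measurable.
rewrite openE => u [Du fu]; apply: filterI; first exact: open_nbhs_nbhs.
by apply: cf => //; apply: open_nbhs_nbhs; split => //; exact: interval_open.
Qed.

Section SurfaceMeasureExistence.
Context {R : realType}.
Variables (alpha : R) (Omega : set 'rV[R]_3).
Hypothesis a0 : 0 < alpha.

Lemma partial_cont c k u : is_graph_chart alpha Omega c -> base c u ->
  {for u, continuous (partial k (height c))}.
Proof.
move=> [_ oB [_ [C HC]] _ _] Bu.
apply/cvgrPdist_lt => e e0.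
pose C' := Num.max C 1.
have C'0 : 0 < C' by rewrite lt_max ltr01 orbT.
pose d := (e / C') `^ (alpha^-1).
have d0 : 0 < d by apply: powR_gt0; exact: divr_gt0.
have nB : nbhs u (base c) by exact: open_nbhs_nbhs.
near=> v.
have Bv : base c v by near: v.
have uv : `|u - v| < d by near: v; exact: (@cvgr_dist_lt _ _ _ (nbhs u) _ (fun v => v) u (@cvg_id _ _) d d0).
apply: le_lt_trans (HC _ _ _ Bu Bv) _.
apply: (@le_lt_trans _ _ (C' * `|u - v| `^ alpha)).
  by rewrite ler_wpM2r ?powR_ge0// le_max lexx.
rewrite mulrC -ltr_pdivlMr//.
have -> : e / C' = d `^ alpha.
  by rewrite /d -powRrM mulVf ?gt_eqF// powRr1// divr_ge0// ltW.
by apply: gt0_ltr_powR => //; rewrite ?nnegrE ?normr_ge0// ltW.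
Unshelve. all: end_near. Qed.

Lemma density_measurable c : is_graph_chart alpha Omega c ->
  measurable_fun (base c) (area_density c).
Proof.
move=> cc; have [_ oB _ _ _] := cc; apply: cont2_measurable => // u Bu.
apply: (@continuous_comp _ _ _ _ (@Num.sqrt R)); last exact: sqrt_continuous.
have -> : (fun v => 1 + \sum_(k < 2) partial k (height c) v ^+ 2) =
    (fun v => 1 + (partial ord0 (height c) v * partial ord0 (height c) v +
      partial (lift ord0 ord0) (height c) v * partial (lift ord0 ord0) (height c) v)).
  by apply/funext => v; rewrite !big_ord_recl big_ord0 addr0 !expr2.
apply: cvgD; first exact: cvg_cst.
by apply: cvgD; apply: cvgM; exact: (partial_cont cc Bu).
Qed.

Lemma graph_point_cont c u : is_graph_chart alpha Omega c -> base c u ->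
  {for u, continuous (graph_point c)}.
Proof.
move=> [_ _ [df _] _ _] Bu.
have hc := differentiable_continuous (df u Bu).
move=> A; rewrite nbhs_simpl => -[/= V nV VA].
suff : \forall v \near u, forall i j, V i j (graph_point c v i j).
  by apply: filterS => v ?; exact: VA.
apply: (@filter_forall _ _ (fun i v => forall j, V i j (graph_point c v i j))
  _ (nbhs_filter u)) => i.
apply: (@filter_forall _ _ (fun j v => V i j (graph_point c v i j))
  _ (nbhs_filter u)) => j.
suff h : (fun v => graph_point c v i j) @ u --> graph_point c u i j by apply: h; exact: nV.
rewrite /graph_point /insert_axis.
under eq_fun do rewrite mxE; rewrite mxE.
case: unlift => [k|]; last exact: hc.
by case: ifP => _; [exact: cvg_fst|exact: cvg_snd].
Qed.

Lemma shadow_graph_point (c : @graph_chart R) u : shadow c (graph_point c u) = u.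
Proof.
rewrite /shadow /graph_point /insert_axis !mxE !liftK /=; by case: u.
Qed.

Lemma preim_measurable (c : @graph_chart R) (A : set (borel3 R)) : is_graph_chart alpha Omega c ->
  measurable A -> A `<=` nbhd c -> measurable (graph_point c @^-1` A).
Proof.
move=> cc mA An; have [_ oB _ nB _] := cc.
have -> : graph_point c @^-1` A = base c `&` graph_point c @^-1` A.
  apply/seteqP; split => [u /= Au|u []//]; split => //.
  by rewrite -(shadow_graph_point c u); exact/nB/An.
have : measurable_fun (base c) (graph_point c : R * R -> borel3 R).
  apply: (@measurability _ _ _ (borel3 R) _ _ (@open 'rV[R]_3)) => // _ [U oU <-].
  apply: open2_measurable; rewrite openE => u [Bu fu]; apply: filterI.
    exact: open_nbhs_nbhs.
  by apply: (graph_point_cont cc Bu); exact: open_nbhs_nbhs.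
by apply => //; exact: open2_measurable.
Qed.

Section piece.
Variables (c : @graph_chart R) (E : set (borel3 R)).
Hypotheses (cc : is_graph_chart alpha Omega c) (mE : measurable E)
  (En : E `<=` nbhd c).
Definition piece (A : set (borel3 R)) : \bar R := graph_area c (A `&` E).
Let piece0 : piece set0 = 0%E.
Proof. by rewrite /piece set0I /graph_area preimage_set0 integral_set0. Qed.
Let piece_ge0 A : (0 <= piece A)%E.
Proof. by apply: integral_ge0 => u _; rewrite lee_fin sqrtr_ge0. Qed.
Let piece_sa : semi_sigma_additive piece.
Proof.
move=> F mF tF mUF; rewrite /piece setI_bigcupl /graph_area preimage_bigcup.
have m k : measurable (graph_point c @^-1` (F k `&` E)).
  apply: preim_measurable => //; first exact: measurableI.
  by move=> x [_ /En].
rewrite ge0_integral_bigcup//=.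
- apply: is_cvg_ereal_nneg_natsum => k _.
  by apply: integral_ge0 => u _; rewrite lee_fin sqrtr_ge0.
- apply/measurable_EFinP.
  apply: (measurable_funS (E := base c)); last exact: density_measurable.
    by have [_ + _ _ _] := cc; exact: open2_measurable.
  move=> u [k _ [_ /En]]; have [_ _ _ nB _] := cc => /nB.
  by rewrite shadow_graph_point.
- by move=> u _; rewrite lee_fin sqrtr_ge0.
- apply/trivIsetP => i j _ _ ij; rewrite -preimage_setI setIACA setIid.
  by move/trivIsetP : tF => ->//; rewrite set0I preimage_set0.
Qed.
Lemma pieceP : exists m : {measure set (borel3 R) -> \bar R}, m =1 piece.
Proof.
pose m : {measure set (borel3 R) -> \bar R} :=
  HB.pack piece (isMeasure.Build _ _ _ piece piece0 piece_ge0 piece_sa).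
by exists m.
Qed.
End piece.

Lemma surface_measure_exists : bounded_domain Omega ->
  C1_holder_boundary alpha Omega ->
  exists sigma : {measure set (borel3 R) -> \bar R},
    is_surface_measure alpha Omega sigma.
Proof.
move=> [_ _ _ bO] HO.
have cF : closed (frontier Omega).
  rewrite /frontier setDE; apply: closedI; first exact: closed_closure.
  exact/open_closedC/open_interior.
have kF : compact (frontier Omega).
  apply: bounded_closed_compact => //.
  have [M [Mr HM]] := bO.
  exists (M + 1); split; first by rewrite realD.
  move=> x Mx P [clP _].
  have h : closed [set Q : 'rV[R]_3 | `|Q| <= x].
    apply: (@preimage_closed _ _ (fun Q : 'rV[R]_3 => `|Q|) [set y | y <= x]).
      by move=> z _; exact: norm_continuous.
    exact: closed_le.
  apply: (h P); apply: closure_subset clP => Q OQ /=.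
  by apply: (HM x) => //; apply: lt_trans Mx; rewrite ltrDl.
have /choice[ch Hch] : forall P, exists c, frontier Omega P ->
    is_graph_chart alpha Omega c /\ nbhd c P.
  move=> P; have [fP|nP] := pselect (frontier Omega P).
    by have [c ? ?] := HO _ fP; exists c.
  by exists (GraphChart setT 0 true setT (fun=> 0)) => /nP.
move: (kF); rewrite compact_cover => /(_ _ (frontier Omega) (fun P => nbhd (ch P))) [].
- by move=> P /Hch[[]].
- by move=> P fP; exists P => //; have [] := Hch P fP.
move=> D' D'F D'c.
pose s : seq 'rV[R]_3 := finmap.enum_fset D'.
pose ck k := ch (nth 0 s k).
pose W k : set (borel3 R) := nbhd (ck k) `&` frontier Omega.
have sF k : (k < size s)%N -> is_graph_chart alpha Omega (ck k).
  move=> ks; have : nth 0 s k \in D' by exact: mem_nth.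
  by move=> /D'F /set_mem/Hch[].
have mW k : (k < size s)%N -> measurable (W k).
  move=> /sF[on _ _ _ _]; apply: measurableI; first exact: sub_gen_smallest.
  rewrite -[frontier _]setCK; apply: measurableC; apply: sub_gen_smallest.
  exact: closed_openC.
pose E (k : 'I_(size s)) := seqDU W k.
have mE k : measurable (E k).
  apply: measurableD; first exact: mW.
  rewrite -bigcup_mkord; apply: bigcup_measurable => j /= jk.
  by apply: mW; exact: ltn_trans jk _.
have En k : E k `<=` nbhd (ck k) by move=> x [[]].
have [m Hm] := choice (fun k : 'I_(size s) =>
  pieceP (sF k (ltn_ord k)) (mE k) (En k)).
pose m' k : {measure set (borel3 R) -> \bar R} :=
  if insub k is Some k' then m k' else mzero.
exists (msum m' (size s)), (size s), (fun k => ck k), E; split => //.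
- by move=> k; exact: sF.
- move=> i j _ _ h; apply: val_inj.
  exact: (@trivIset_seqDU _ W i j I I h).
- apply/seteqP; split => [x [k _ [[]]]//|x fx].
  have [P /= PD' xP] := D'c _ fx.
  have : (\bigcup_k W k) x by exists (index P s) => //; split => //; rewrite /ck nth_index.
  pose k0 := index P s.
  have k0s : (k0 < size s)%N by rewrite index_mem.
  have : exists k, `[< W k x >].
    by exists k0; apply/asboolP; split => //; rewrite /ck nth_index.
  move=> ex _; case: (ex_minnP ex) => k /asboolP Wk mink.
  have kk0 : (k <= k0)%N.
    by apply: mink; apply/asboolP; split => //; rewrite /ck nth_index.
  exists (Ordinal (leq_ltn_trans kk0 k0s)) => //; split => //=.
  rewrite -bigcup_mkord => -[j /= jk Wj].
  by have := mink j (asboolT Wj); rewrite leqNgt jk.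
- move=> A mA; rewrite /= /msum; apply: eq_bigr => k _.
  by rewrite /m' valK Hm.
Qed.
End SurfaceMeasureExistence.

(* Main.v *)
Require Import Defs.
From mathcomp Require Import all_boot all_order all_algebra.
From mathcomp Require Import all_classical all_reals all_analysis.
From mathcomp Require Import lra ring measurable_realfun.
Import Order.TTheory GRing.Theory Num.Theory.
Import numFieldNormedType.Exports.
Local Open Scope classical_set_scope.
Local Open Scope ring_scope.

(** Two facts about the boundary carry the bound.

    Tangency ([lyapunov]): for P and Q on the boundary,
    |(P - Q) . n_P| <= C |P - Q|^(1 + alpha).  Inside one chart this is Taylor's
    formula with a Hoelder gradient ([taylor_holder]), and compactness makes C
    uniform.  The normal vector n_P may come from another chart than the one
    used for the estimate; normals from two charts are parallel
    ([raw_normal_parallel]), and the absolute value forgets their sign.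

    Size ([surface_measure_regular]): a ball of radius r around an arbitrary
    point M of space carries surface measure at most K r^2.  Every piece of the
    boundary projects injectively into a square of side 2 r, with bounded area
    density; the projection is the one of the chart the piece is measured
    with, so that charts never have to be compared through a change of
    variables.

    Given M, let Q be a point of the boundary at minimal distance h from M, and
    put s = |P - M| for P on the boundary.  Then h <= s and |P - Q| <= 2 s, so
    splitting P - M as (P - Q) + (Q - M) bounds the integrand by
    3 h s^(-3) + C' s^(alpha - 2) ([kernel_le]).  Both terms are integrated
    over dyadic shells around M with the size estimate: the first over
    2^j h <= s < 2^(j + 1) h, where the shells contribute multiples of 2^(-j)
    whatever h is ([integral_far_le]); the second over
    2^(-j - 1) < s <= 2^(-j), where they contribute multiples of 2^(-j alpha)
    ([integral_near_le]).  Neither bound depends on M.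

    Distances are measured in the sup norm, which is at most the Euclidean norm
    of the denominator ([norm_le_enorm]). *)

(** * Integration over dyadic shells *)

Section MeasureTheory.
Context d (T : measurableType d) (R : realType).
Variable mu : {measure set T -> \bar R}.

(** The integral of a nonnegative f is the supremum over the simple functions
    below f, whatever f is.  The integrand of the theorem is handled in this
    way, as its normal vector is selected by choice. *)
Lemma ge0_le_integral_nonmeasurable (D : set T) (f g : T -> \bar R) :
  (forall x, D x -> (0 <= f x)%E) -> (forall x, D x -> (f x <= g x)%E) ->
  (\int[mu]_(x in D) f x <= \int[mu]_(x in D) g x)%E.
Proof.
move=> f0 fg; rewrite !ge0_integralE//; last first.
  by move=> x Dx; exact: le_trans (f0 _ Dx) (fg _ Dx).
apply: le_ereal_sup => _ [h hf <-]; exists h => // x.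
by apply: le_trans (hf x) _; exact: lee_restrict.
Qed.

(** The step function which sums a j on A j dominates f, and its integral is a
    geometric series.  This replaces polar coordinates: a kernel that blows up
    at a point is covered by balls around that point. *)
Lemma integral_geometric_cover (D : set T) (f : T -> R) (A : nat -> set T)
    (a : nat -> R) (B q : R) :
  measurable D -> (forall j, measurable (A j)) ->
  (forall x, D x -> 0 <= f x) -> (forall j, 0 <= a j) ->
  (forall x, D x -> exists2 j, A j x & f x <= a j) ->
  0 <= q < 1 ->
  (forall j, ((a j)%:E * mu (A j `&` D) <= (B * q ^+ j)%:E)%E) ->
  (\int[mu]_(x in D) (f x)%:E <= (B / (1 - q))%:E)%E.
Proof.
move=> mD mA f0 a0 cov /andP[q0 q1] small.
pose g j x := (a j * \1_(A j) x)%:E.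
have g0 j x : (0 <= g j x)%E by rewrite lee_fin mulr_ge0.
have mg j : measurable_fun D (g j).
  apply: measurableT_comp => //; apply: measurable_funM => //.
apply: (@le_trans _ _ (\int[mu]_(x in D) (\sum_(j <oo) g j x))%E).
  apply: ge0_le_integral_nonmeasurable => x Dx; first by rewrite lee_fin f0.
  have [j Ajx fa] := cov _ Dx.
  apply: le_trans (nneseries_lim_ge j.+1 _) => //.
  rewrite big_nat_recr//=; apply: le_trans (leeDr _ _); last exact: sume_ge0.
  by rewrite /g lee_fin indicE mem_set// mulr1.
rewrite integral_nneseries//.
have gE j : (\int[mu]_(x in D) g j x <= (B * q ^+ j)%:E)%E.
  under eq_integral do rewrite /g EFinM.
  rewrite ge0_integralZl ?lee_fin ?integral_indic //.
  by apply: measurableT_comp => //.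
apply: (le_trans (lee_nneseries _ (fun j _ => gE j))).
  by move=> j _ _; apply: integral_ge0.
have q1' : `|q| < 1 by rewrite ger0_norm.
have cv := @cvg_geometric_series R B q q1'.
rewrite (_ : (\sum_(j <oo) (B * q ^+ j)%:E)%E = (B / (1 - q))%:E)//.
apply/cvg_lim => //; rewrite (_ : (fun n => _) = EFin \o series (geometric B q)).
  by apply: cvg_EFin => //; exact: nearW.
by apply/funext => n /=; rewrite -sumEFin.
Qed.
End MeasureTheory.

Lemma dyadic_bracket (R : realType) (x : R) : 1 <= x ->
  exists j, 2 ^+ j <= x < 2 ^+ j.+1.
Proof.
move=> x1.
have ex : exists n, x < 2 ^+ n.
  exists (Num.truncn x).+1.
  apply: (lt_le_trans (truncnS_gt _)).
  by rewrite -natrX ler_nat; apply: ltnW; exact: ltn_expl.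
case: (ex_minnP ex) => [[|j] xj minj]; first by rewrite expr0 in xj; lra.
exists j; rewrite xj andbT leNgt; apply/negP => /minj; by rewrite ltnn.
Qed.

Lemma ler_powRN (R : realType) (x y p : R) : 0 < x -> x <= y -> 0 <= p ->
  y `^ (- p) <= x `^ (- p).
Proof.
move=> x0 xy p0; have y0 := lt_le_trans x0 xy.
rewrite !powRN lef_pV2 ?posrE ?powR_gt0//.
by apply: ge0_ler_powR; rewrite ?nnegrE// ltW.
Qed.

Lemma powR_sub2M (R : realType) (x a : R) : 0 < x ->
  x `^ (a - 2) * x ^+ 2 = x `^ a.
Proof.
move=> x0; rewrite -(powR_mulrn 2 (ltW x0)) -powRD ?subrK//.
by rewrite (gt_eqF x0) implybT.
Qed.

Lemma ler_div_cube (R : realType) (N h A x a : R) : 0 < x ->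
  N <= 3 * h + A * x `^ (1 + a) ->
  N / x ^+ 3 <= 3 * (h * x `^ (- 3)) + A * x `^ (a - 2).
Proof.
move=> x0; have x30 : 0 < x ^+ 3 by rewrite exprn_gt0.
have -> : x `^ (1 + a) = x `^ (a - 2) * x ^+ 3.
  rewrite exprS mulrCA powR_sub2M// powRD ?powRr1 ?ltW//.
  by rewrite (gt_eqF x0) implybT.
rewrite ler_pdivrMr// (powR_invn 3 (ltW x0)).
have x3 : x ^- 3 * x ^+ 3 = 1 by rewrite mulVf ?(gt_eqF x30).
move=> hN; apply: le_trans hN _.
move: (x `^ _) x3 => z; move: (x ^- 3) => y; move: (x ^+ 3) => w yw.
have -> : (3 * (h * y) + A * z) * w = 3 * h * (y * w) + A * (z * w) by ring.
by rewrite yw mulr1.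
Qed.

Lemma measurable_sublevel d (T : measurableType d) (R : realType) (s : T -> R)
    (r : R) :
  measurable_fun [set: T] s -> measurable [set x | s x <= r].
Proof.
move=> ms; rewrite (_ : [set x | s x <= r] = setT `&` s @^-1` `]-oo, r]%classic).
  by apply: ms => //; exact: measurable_itv.
by apply/seteqP; split => x /=; rewrite in_itv/=; [split|case].
Qed.

(** In this section s is the distance to a point and the measure of a ball of
    radius r around this point is at most K r^2. *)
Section Kernels.
Context d (T : measurableType d) (R : realType).
Variable mu : {measure set T -> \bar R}.
Variables (D : set T) (s : T -> R) (K : R).
Hypotheses (mD : measurable D) (ms : measurable_fun [set: T] s).
Hypotheses (s0 : forall x, 0 <= s x) (K0 : 0 <= K).
Hypothesis regular : forall r : R, 0 <= r ->
  (mu ([set x | (s x <= r)%R] `&` D) <= (K * r ^+ 2)%:E)%E.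

(** The kernel h s^(-3) has scale h and lives where s >= h, so its integral does
    not degenerate as h tends to 0: the ball of radius 2^(j + 1) h contributes
    at most h (2^j h)^(-3) K (2^(j + 1) h)^2 = 4 K 2^(-j). *)
Lemma integral_far_le (h : R) : 0 <= h -> (forall x, D x -> h <= s x) ->
  (\int[mu]_(x in D) (h * s x `^ (- 3))%:E <= (8 * K)%:E)%E.
Proof.
rewrite le_eqVlt => /predU1P[<- _|h0 hs].
  under eq_integral do rewrite mul0r.
  by rewrite integral0 lee_fin mulr_ge0.
have e0 (j : nat) : 0 < h * 2 ^+ j by rewrite mulr_gt0 ?exprn_gt0.
have -> : 8 * K = 4 * K / (1 - 2^-1) by field.
apply: (integral_geometric_cover _ _ _ _ _ _
  (fun j => [set x | s x <= h * 2 ^+ j.+1])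
  (fun j => h * (h * 2 ^+ j) `^ (- 3))) => //.
- by move=> j; exact: measurable_sublevel.
- by move=> x _; rewrite mulr_ge0 ?powR_ge0 ?ltW.
- by move=> j; rewrite mulr_ge0 ?powR_ge0 ?ltW.
- move=> x Dx; have [|j /andP[j1 j2]] := dyadic_bracket _ (s x / h).
    by rewrite ler_pdivlMr// mul1r hs.
  exists j; first by rewrite /= mulrC -ler_pdivrMr// ltW.
  apply: ler_wpM2l; first exact: ltW.
  by apply: ler_powRN => //; rewrite mulrC -ler_pdivlMr.
- by lra.
- move=> j; apply: (@le_trans _ _
    ((h * (h * 2 ^+ j) `^ (- 3))%:E * (K * (h * 2 ^+ j.+1) ^+ 2)%:E)%E).
    apply: lee_wpmul2l; first by rewrite lee_fin mulr_ge0 ?powR_ge0 ?ltW.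
    by apply: regular; rewrite ltW.
  rewrite -EFinM lee_fin (powR_invn 3 (ltW (e0 j))) (exprS 2 j) exprVn.
  have := e0 j; set p := 2 ^+ j => p0.
  have p1 : p != 0 by rewrite expf_neq0.
  rewrite le_eqVlt; apply/orP; left; apply/eqP; field.
  by rewrite p1 gt_eqF.
Qed.

(** As alpha <= 1, the kernel is at most 1 where s >= 1, and this region takes
    the index 0 of the cover; where s <= 1, the ball of radius 2^(-j) has index
    j + 1 and contributes at most 4 K 2^(-(j + 1) alpha). *)
Lemma integral_near_le (alpha K1 : R) : 0 < alpha <= 1 ->
  (mu D <= K1%:E)%E ->
  (\int[mu]_(x in D) (s x `^ (alpha - 2))%:E <=
     ((K1 + 4 * K) / (1 - 2^-1 `^ alpha))%:E)%E.
Proof.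
move=> /andP[a0 a1] DK1.
have K10 : 0 <= K1 by rewrite -lee_fin; exact: le_trans DK1.
have h0 (j : nat) : 0 < 2^-1 ^+ j :> R by rewrite exprn_gt0.
have aE : alpha - 2 = - (2 - alpha) by ring.
have a2 : 0 <= 2 - alpha by lra.
pose A j := if j is i.+1 then [set x | s x <= 2^-1 ^+ i] else setT.
pose a j : R := if j is i.+1 then (2^-1 ^+ i.+1) `^ (alpha - 2) else 1.
have q01 : 0 <= (2^-1 : R) `^ alpha < 1.
  rewrite powR_ge0 /= [ltRHS](_ : 1 = 1 `^ alpha); last by rewrite powR1.
  by apply: gt0_ltr_powR; rewrite ?nnegrE//; lra.
apply: (integral_geometric_cover _ _ _ _ _ _ A a) => //.
- by case=> [|j]; [exact: measurableT|exact: measurable_sublevel].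
- by move=> x _; exact: powR_ge0.
- by case=> [|j]; [exact: ler01|exact: powR_ge0].
- move=> x Dx; have := s0 x; rewrite le_eqVlt => /predU1P[<-|sx0].
    (* The power is 0 at s = 0, so the centre fits into index 0. *)
    exists 0%N => //=; rewrite /powR eqxx; case: eqP => //; lra.
  have [sx1|sx1] := leP 1 (s x).
    exists 0%N => //=; rewrite aE.
    by apply: le_trans (ler_powRN _ _ _ _ ltr01 sx1 a2) _; rewrite powR1.
  have [|j /andP[j1 j2]] := dyadic_bracket _ (s x)^-1.
    by rewrite invf_ge1// ltW.
  exists j.+1 => /=.
    by rewrite exprVn -[leLHS]invrK lef_pV2 ?posrE ?invr_gt0 ?exprn_gt0.
  rewrite aE; apply: ler_powRN => //.
  by rewrite exprVn -[leRHS]invrK lef_pV2 ?posrE ?invr_gt0 ?exprn_gt0 ?ltW.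
- case=> [|j] /=.
    rewrite mul1e setTI expr0 mulr1; apply: le_trans DK1 _.
    by rewrite lee_fin lerDl mulr_ge0.
  set t := 2^-1 ^+ j.+1.
  have tE : 2^-1 ^+ j = 2 * t by rewrite /t exprS mulrA divff ?mul1r.
  apply: (@le_trans _ _ ((t `^ (alpha - 2))%:E * (K * (2 * t) ^+ 2)%:E)%E).
    apply: lee_wpmul2l; first by rewrite lee_fin powR_ge0.
    by rewrite -tE; apply: regular; exact: ltW.
  rewrite -EFinM lee_fin.
  have -> : t `^ (alpha - 2) * (K * (2 * t) ^+ 2) =
      4 * K * (t `^ (alpha - 2) * t ^+ 2) by ring.
  rewrite powR_sub2M; last exact: h0.
  rewrite -(powR_mulrn j.+1 (powR_ge0 _ _)) -powRrM mulrC.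
  have -> : t `^ alpha = 2^-1 `^ (alpha * j.+1%:R).
    by rewrite /t -powR_mulrn ?invr_ge0// -powRrM mulrC.
  by rewrite mulrC; apply: ler_wpM2r; [exact: powR_ge0|rewrite lerDr].
Qed.
End Kernels.

(** * Tangent planes of graphs *)

Lemma is_derive_comp2 (R : realType) (phi : R * R -> R) (x y : R -> R)
    (t x' y' : R) :
  differentiable phi (x t, y t) -> is_derive t 1 x x' -> is_derive t 1 y y' ->
  is_derive t 1 (fun s => phi (x s, y s))
    (partial 0 phi (x t, y t) * x' + partial 1 phi (x t, y t) * y').
Proof.
move=> dphi [dx <-] [dy <-].
have dfx : differentiable x t by apply/derivable1_diffP.
have dfy : differentiable y t by apply/derivable1_diffP.
have dg := differentiable_pair dfx dfy.
have dc : differentiable (phi \o (fun s => (x s, y s))) t.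
  exact: differentiable_comp.
apply: DeriveDef; first by apply/derivable1_diffP.
rewrite (deriveE _ dc) diff_comp// diff_pair// /= /partial /=.
rewrite -!deriveE//.
set a := 'D_1 x t; set b := 'D_1 y t.
have -> : (a, b) = a *: (1, 0) + b *: (0, 1) :> R * R.
  by congr pair; rewrite /= !scaler0 ?addr0 ?add0r /GRing.scale/= mulr1.
by rewrite !deriveE// linearD !linearZ /= /GRing.scale/= mulrC [b * _]mulrC.
Qed.

Lemma ord2_case (k : 'I_2) : k = 0 \/ k = 1.
Proof. by case: k => [[|[|//]] k2]; [left|right]; exact: val_inj. Qed.

Section Chart.
Context {R : realType}.
Implicit Types (c : @graph_chart R) (u e : R * R) (v P Q : 'rV[R]_3).

(** The derivative of phi at u in the direction e. *)
Definition directional (phi : R * R -> R) u e : R :=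
  partial 0 phi u * e.1 + partial 1 phi u * e.2.

(** The upward normal of the graph, scaled so that its [axis] coordinate is 1: in
    this scale it is affine in the gradient of the height. *)
Definition raw_normal c u : 'rV[R]_3 :=
  insert_axis c 1 (fun k => - partial k (height c) u).

(** The image of e under the differential of the graph parametrization. *)
Definition tangent c u e : 'rV[R]_3 :=
  insert_axis c (directional (height c) u e)
    (fun k => if k == 0 then e.1 else e.2).

Lemma insert_axisE c z a : insert_axis c z a 0 (axis c) = z.
Proof. by rewrite mxE unlift_none. Qed.

Lemma insert_axis_lift c z a k : insert_axis c z a 0 (lift (axis c) k) = a k.
Proof. by rewrite mxE liftK. Qed.

Lemma dot_insert_axis c v z a :
  dot v (insert_axis c z a) =
  v 0 (axis c) * z +
    (v 0 (lift (axis c) 0) * a 0 + v 0 (lift (axis c) 1) * a 1).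
Proof.
rewrite /dot (bigD1_ord (axis c))//= insert_axisE; congr (_ + _).
rewrite !big_ord_recl big_ord0 addr0 !insert_axis_lift.
by rewrite (_ : lift ord0 ord0 = 1)//; exact: val_inj.
Qed.

Lemma graph_velocity c u e j : differentiable (height c) u ->
  is_derive (0 : R) 1
    (fun t : R => graph_point c (u.1 + t * e.1, u.2 + t * e.2) 0 j)
    (tangent c u e 0 j).
Proof.
move=> dphi.
have line (p q : R) : is_derive (0 : R) 1 (fun t : R => p + t * q) q.
  apply: is_derive_eq; rewrite /GRing.scale/=; ring.
have line0 (p q : R) : p + 0 * q = p by rewrite mul0r addr0.
rewrite /graph_point /tangent /insert_axis mxE.
under eq_fun do rewrite mxE.
case: (unlift (axis c) j) => [k|]; first by case: ifP => _; exact: line.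
have := @is_derive_comp2 R (height c) (fun t => u.1 + t * e.1)
  (fun t => u.2 + t * e.2) 0 e.1 e.2.
by rewrite !line0 -surjective_pairing; apply.
Qed.

(** A curve drawn on the boundary with the help of the chart c0 satisfies the
    graph equation of c near P; differentiating that equation along the curve
    shows that the velocity is orthogonal to the normal of c. *)
Lemma raw_normal_tangent alpha Omega c c0 P e :
  is_graph_chart alpha Omega c -> is_graph_chart alpha Omega c0 ->
  frontier Omega P -> nbhd c P -> nbhd c0 P ->
  dot (tangent c0 (shadow c0 P) e) (raw_normal c (shadow c P)) = 0.
Proof.
move=> cc cc0 fP cP c0P.
have [on ob [dh _] nb eqs] := cc; have [on0 ob0 [dh0 _] nb0 eqs0] := cc0.
set u0 := shadow c0 P; set u := shadow c P.
have Bu0 : base c0 u0 by exact: nb0.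
pose line (t : R) := (u0.1 + t * e.1, u0.2 + t * e.2).
pose g (t : R) := graph_point c0 (line t).
have line00 : line 0 = u0 by rewrite /line !mul0r !addr0 -surjective_pairing.
have g0 : g 0 = P.
  rewrite /g line00; apply/rowP => j; rewrite mxE.
  case: unliftP => [k|] ->; last by apply/esym; exact: (eqs0 _ c0P).1.1.
  by have [->|->] := ord2_case k.
have vel j := @graph_velocity c0 u0 e j (dh0 _ Bu0).
have gcont : g @ (0 : R) --> P.
  rewrite -g0; apply: continuous_comp; last first.
    by rewrite line00; exact: (graph_point_cont cc0 Bu0).
  have cl (p q : R) : (fun t => p + t * q) @ (0 : R) --> p + 0 * q.
    by apply: cvgD; [exact: cvg_cst|apply: cvgM; [exact: cvg_id|exact: cvg_cst]].
  exact: (cvg_pair (cl u0.1 e.1) (cl u0.2 e.2)).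
pose F t := g t 0 (axis c) - 
  height c (g t 0 (lift (axis c) 0), g t 0 (lift (axis c) 1)).
have F0 : \forall t \near (0 : R), F t = 0.
  have n : \forall t \near (0 : R), nbhd c (g t).
    by apply: gcont; exact: open_nbhs_nbhs.
  have n0 : \forall t \near (0 : R), nbhd c0 (g t).
    by apply: gcont; exact: open_nbhs_nbhs.
  near=> t.
  have nt : nbhd c (g t) by near: t.
  have n0t : nbhd c0 (g t) by near: t.
  apply/eqP; rewrite subr_eq0; apply/eqP/(eqs _ nt).1/(eqs0 _ n0t).1.
  by rewrite /g shadow_graph_point insert_axisE.
have dF : is_derive (0 : R) 1 F (tangent c0 u0 e 0 (axis c) -
    (partial 0 (height c) u * tangent c0 u0 e 0 (lift (axis c) 0) +
     partial 1 (height c) u * tangent c0 u0 e 0 (lift (axis c) 1))).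
  have := @is_derive_comp2 R (height c) (fun t => g t 0 (lift (axis c) 0))
    (fun t => g t 0 (lift (axis c) 1)) 0 _ _ _ (vel _) (vel _).
  rewrite g0 => /(_ (dh _ (nb _ cP))) dphi.
  exact: is_deriveB (vel (axis c)) dphi.
have dF0 : is_derive (0 : R) 1 F 0.
  apply: near_eq_is_derive (is_derive_cst (0 : R) (0 : R) 1).
  by near=> t; apply/esym; near: t.
rewrite dot_insert_axis mulr1 !mulrN -opprD.
have [_ <-] := dF0; have [_ ->] := dF.
ring.
Unshelve. all: end_near. Qed.

(** The orthogonal complement of the tangent plane read off from c0 is the line
    of the normal of c0. *)
Lemma raw_normal_parallel alpha Omega c c0 P :
  is_graph_chart alpha Omega c -> is_graph_chart alpha Omega c0 ->
  frontier Omega P -> nbhd c P -> nbhd c0 P ->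
  raw_normal c (shadow c P) =
  raw_normal c (shadow c P) 0 (axis c0) *: raw_normal c0 (shadow c0 P).
Proof.
move=> cc cc0 fP cP c0P; set N := raw_normal c _.
have tN e := @raw_normal_tangent alpha Omega c c0 P e cc cc0 fP cP c0P.
have dotC v w : dot v w = dot w v by apply: eq_bigr => i _; rewrite mulrC.
apply/rowP => j; rewrite [RHS]mxE.
case: (unliftP (axis c0) j) => [k|] ->; last by rewrite insert_axisE mulr1.
rewrite insert_axis_lift.
have := tN (1, 0); have := tN (0, 1).
rewrite -/N !(dotC _ N) !(dot_insert_axis c0) /directional /=.
rewrite !mulr0 !mulr1 !addr0 !add0r.
have [->|->] := ord2_case k.
- by move=> _ /eqP; rewrite addrC addr_eq0 mulrN => /eqP.
- by move=> /eqP + _; rewrite addrC addr_eq0 mulrN => /eqP.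
Qed.
End Chart.

(** * The tangency estimate *)

Section Estimates.
Context {R : realType}.
Implicit Types (c : @graph_chart R) (P Q : 'rV[R]_3).

Lemma coord_le_norm (v : 'rV[R]_3) j : `|v 0 j| <= `|v|.
Proof.
rewrite [leRHS]mx_normrE.
exact: (le_bigmax _ (fun ij => `|v ij.1 ij.2|) (0, j)).
Qed.

Lemma dot_le (v w : 'rV[R]_3) (m : R) : (forall j, `|w 0 j| <= m) ->
  `|dot v w| <= 3 * m * `|v|.
Proof.
move=> wm; apply: le_trans (ler_norm_sum _ _ _) _.
apply: (@le_trans _ _ (\sum_(i < 3) m * `|v|)); last first.
  by rewrite sumr_const card_ord; lra.
apply: ler_sum => i _; rewrite normrM mulrC.
by apply: ler_pM => //; exact: coord_le_norm.
Qed.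

Lemma norm_le_enorm (v : 'rV[R]_3) : `|v| <= enorm v.
Proof.
rewrite [leLHS]mx_normrE; apply/bigmax_leP; split => [|[i j] _ /=].
  exact: sqrtr_ge0.
rewrite (ord1 i) -sqrtr_sqr /enorm ler_wsqrtr// /dot (bigD1 j)//= -expr2 lerDl.
by apply: sumr_ge0 => k _; rewrite -expr2 sqr_ge0.
Qed.

Lemma shadow_norm_le c P : `|shadow c P| <= `|P|.
Proof. by rewrite prod_normE ge_max !coord_le_norm. Qed.

Lemma shadowB c P Q : shadow c P - shadow c Q = shadow c (P - Q).
Proof. by rewrite /shadow !mxE. Qed.

Lemma directional_le (phi : R * R -> R) u w e (m : R) :
  (forall k : 'I_2, `|partial k phi u - partial k phi w| <= m) ->
  `|directional phi u e - directional phi w e| <= 2 * m * `|e|.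
Proof.
move=> hm; rewrite /directional.
have -> : partial 0 phi u * e.1 + partial 1 phi u * e.2 -
    (partial 0 phi w * e.1 + partial 1 phi w * e.2) =
  (partial 0 phi u - partial 0 phi w) * e.1 +
  (partial 1 phi u - partial 1 phi w) * e.2 by ring.
apply: le_trans (ler_normD _ _) _; rewrite !normrM.
have -> : 2 * m * `|e| = m * `|e| + m * `|e| by ring.
by apply: lerD; apply: ler_pM => //; rewrite prod_normE le_max lexx ?orbT.
Qed.

(** The mean value theorem on the segment from v to u evaluates the increment of
    phi with the derivative at an intermediate point, which the Hoelder
    condition compares with the derivative at u; balls are convex. *)
Lemma taylor_holder (alpha r C : R) (phi : R * R -> R) a u v :
  0 <= alpha -> 0 <= C ->
  (forall w, ball a r w -> differentiable phi w) ->
  (forall (k : 'I_2) w1 w2, ball a r w1 -> ball a r w2 ->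
     `|partial k phi w1 - partial k phi w2| <= C * `|w1 - w2| `^ alpha) ->
  ball a r u -> ball a r v ->
  `|phi u - phi v - directional phi u (u - v)| <=
    2 * C * `|u - v| `^ (1 + alpha).
Proof.
move=> a0 C0 dphi hold au av; set e := u - v.
pose line (t : R) := (v.1 + t * e.1, v.2 + t * e.2).
have inb t : 0 <= t <= 1 -> ball a r (line t).
  move=> t01.
  have seg (p q s : R) : ball p r q -> ball p r s -> ball p r (s + t * (q - s)).
    rewrite /ball/= !ltr_norml => /andP[q1 q2] /andP[s1 s2]; apply/andP.
    case/andP: t01; rewrite le_eqVlt => /predU1P[<- _|t0 t1].
      by rewrite mul0r addr0.
    have := mulr_gt0 t0 (ltac:(lra) : 0 < r - (p - q)).
    have := mulr_gt0 t0 (ltac:(lra) : 0 < r + (p - q)).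
    have := mulr_ge0 (ltac:(lra) : 0 <= 1 - t) (ltac:(lra) : 0 <= r - (p - s)).
    have := mulr_ge0 (ltac:(lra) : 0 <= 1 - t) (ltac:(lra) : 0 <= r + (p - s)).
    by split; lra.
  by case: au av => ? ? [? ?]; split; exact: seg.
have line1 : line 1 = u by rewrite /line !mul1r /= !subrKC; case: (u).
have line0 : line 0 = v by rewrite /line !mul0r !addr0; case: (v).
have der (t : R) : 0 <= t <= 1 ->
    is_derive t 1 (phi \o line) (directional phi (line t) e).
  move=> t01; have aff (p q : R) : is_derive t 1 (fun t : R => p + t * q) q.
    apply: is_derive_eq; rewrite /GRing.scale/=; ring.
  by apply: is_derive_comp2; exact/dphi/inb.
have [t] : exists2 t, t \in `[0, 1]%R &
    (phi \o line) 1 - (phi \o line) 0 = directional phi (line t) e * (1 - 0).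
  apply: (MVT_segment ler01) => [t /[!in_itv]/= /andP[t0 t1]|].
    by apply: der; rewrite !ltW.
  apply: derivable_within_continuous => t /[!in_itv]/= t01.
  by have [] := der t t01.
rewrite in_itv/= line1 line0 subr0 mulr1 => t01 ->.
rewrite powRD ?powRr1//; last by rewrite gt_eqF ?implyFb//; lra.
have -> : 2 * C * (`|e| * `|e| `^ alpha) = 2 * (C * `|e| `^ alpha) * `|e| by ring.
apply: directional_le => k.
apply: le_trans (hold _ _ _ (inb _ t01) au) _; apply: ler_wpM2l => //.
apply: ge0_ler_powR; rewrite ?nnegrE//.
have -> : line t - u = (t - 1) *: e.
  by rewrite -line1 /line; congr pair; rewrite /GRing.scale/=; ring.
rewrite normrZ; apply: ler_piMl => //; rewrite ler_norml; lra.
Qed.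
End Estimates.

Section ExteriorNormal.
Context {R : realType}.
Implicit Types (c : @graph_chart R) (P Q : 'rV[R]_3).

Lemma dotZr (a : R) (v w : 'rV[R]_3) : dot v (a *: w) = a * dot v w.
Proof. by rewrite /dot mulr_sumr; apply: eq_bigr => j _; rewrite mxE mulrCA. Qed.

Lemma area_density_ge1 c u : 1 <= area_density c u.
Proof.
rewrite -[leLHS]sqrtr1 ler_wsqrtr// lerDl.
by apply: sumr_ge0 => k _; rewrite sqr_ge0.
Qed.

Lemma raw_normal_le c u j : `|raw_normal c u 0 j| <= area_density c u.
Proof.
rewrite /raw_normal mxE; case: unliftP => [k|] _.
  rewrite normrN -sqrtr_sqr ler_wsqrtr// (bigD1 k)//= addrCA lerDl.
  by apply: addr_ge0 => //; apply: sumr_ge0 => l _; rewrite sqr_ge0.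
by rewrite normr1 area_density_ge1.
Qed.

Lemma chart_normalE c u :
  chart_normal c u = ((-1) ^+ above c / area_density c u) *: raw_normal c u.
Proof. by []. Qed.

Lemma chart_normal_le1 c u j : `|chart_normal c u 0 j| <= 1.
Proof.
have A1 := area_density_ge1 c u.
rewrite chart_normalE mxE normrM normrM normrX normrN1 expr1n mul1r normfV.
rewrite mulrC ler_pdivrMr ?normr_gt0 ?gt_eqF ?(lt_le_trans ltr01)// mul1r.
by apply: le_trans (raw_normal_le c u j) (ler_norm _).
Qed.

Section Boundary.
Variables (alpha : R) (Omega : set 'rV[R]_3).
Hypothesis HO : C1_holder_boundary alpha Omega.

Lemma exterior_normalP P : frontier Omega P ->
  exists c, [/\ is_graph_chart alpha Omega c, nbhd c P &
                exterior_normal alpha Omega P = chart_normal c (shadow c P)].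
Proof.
move=> fP; have [c cc cP] := HO P fP.
rewrite /exterior_normal; case: xgetP => [v -> [_ [c' [? ? ?]]]|].
  by exists c'.
by move=> /(_ (chart_normal c (shadow c P)))[]; split => //; exists c.
Qed.

Lemma exterior_normal_le1 P j : frontier Omega P ->
  `|exterior_normal alpha Omega P 0 j| <= 1.
Proof. by move=> /exterior_normalP[c [_ _ ->]]; exact: chart_normal_le1. Qed.

(** The exterior normal is a multiple of the normal of c, and the factor is its
    own [axis] coordinate, hence at most 1 in absolute value. *)
Lemma dot_exterior_normal_le c P (v : 'rV[R]_3) :
  is_graph_chart alpha Omega c -> frontier Omega P -> nbhd c P ->
  `|dot v (exterior_normal alpha Omega P)| <=
  `|dot v (raw_normal c (shadow c P))|.
Proof.
move=> cc fP cP; have [c' [cc' c'P nE]] := exterior_normalP _ fP.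
have := exterior_normal_le1 P (axis c) fP.
rewrite nE chart_normalE mxE => le1.
rewrite dotZr (raw_normal_parallel _ _ _ _ _ cc' cc fP c'P cP) dotZr.
rewrite mulrA normrM.
exact: ler_piMl.
Qed.

(** For P and Q in the same chart, (P - Q) . N_P is the error of the first
    order Taylor expansion of the height function. *)
Lemma lyapunov_near P0 : 0 <= alpha -> frontier Omega P0 ->
  exists r C : R, [/\ 0 < r, 0 <= C & forall P Q,
    frontier Omega P -> frontier Omega Q -> `|P0 - P| < r -> `|P0 - Q| < r ->
    `|dot (P - Q) (exterior_normal alpha Omega P)| <=
      C * `|P - Q| `^ (1 + alpha)].
Proof.
move=> a0 fP0; have [c cc cP0] := HO P0 fP0.
have [on ob [dh [C hC]] nb eqs] := cc.
have /nbhs_ballP[r1 /= r10 h1] := open_nbhs_nbhs (conj on cP0).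
have /nbhs_ballP[r2 /= r20 h2] := open_nbhs_nbhs (conj ob (nb _ cP0)).
pose C' := Num.max C 0; have C'0 : 0 <= C' by rewrite le_max lexx orbT.
exists (Num.min r1 r2), (2 * C'); split; first by rewrite lt_min r10.
  exact: mulr_ge0.
move=> P Q fP fQ; rewrite !lt_min => /andP[P1 P2] /andP[Q1 Q2].
have cP : nbhd c P by apply: h1; rewrite mx_norm_ball.
have cQ : nbhd c Q by apply: h1; rewrite mx_norm_ball.
have near_shadow X : `|P0 - X| < r2 -> ball (shadow c P0) r2 (shadow c X).
  move=> lX; split; rewrite /ball/=; apply: le_lt_trans lX.
    by have := coord_le_norm (P0 - X) (lift (axis c) 0); rewrite !mxE.
  by have := coord_le_norm (P0 - X) (lift (axis c) 1); rewrite !mxE.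
apply: le_trans (dot_exterior_normal_le _ _ _ cc fP cP) _.
have -> : dot (P - Q) (raw_normal c (shadow c P)) =
    height c (shadow c P) - height c (shadow c Q) -
    directional (height c) (shadow c P) (shadow c P - shadow c Q).
  rewrite dot_insert_axis /directional shadowB /= !mxE.
  rewrite (eqs _ cP).1.1// (eqs _ cQ).1.1//.
  ring.
apply: le_trans (taylor_holder alpha r2 C' _ (shadow c P0) _ _ a0 C'0 _ _
  (near_shadow _ P2) (near_shadow _ Q2)) _ =>
  [w /h2/dh//|k w1 w2 /h2 b1 /h2 b2|].
  apply: le_trans (hC _ _ _ b1 b2) _; apply: ler_wpM2r; first exact: powR_ge0.
  by rewrite le_max lexx.
apply: ler_wpM2l; first exact: mulr_ge0.
apply: ge0_ler_powR; rewrite ?nnegrE//; first exact: addr_ge0.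
by rewrite shadowB shadow_norm_le.
Qed.

(** Close points are handled by [lyapunov_near]; for |P - Q| >= r / 2 the
    trivial bound 3 |P - Q| is at most
    3 (r / 2)^(- alpha) |P - Q|^(1 + alpha).  The inequality then holds near
    every boundary point for all large C, and compactness gives one C for the
    whole boundary. *)
Lemma lyapunov : 0 <= alpha -> compact (frontier Omega) ->
  exists2 C : R, 0 <= C & forall P Q, frontier Omega P -> frontier Omega Q ->
    `|dot (P - Q) (exterior_normal alpha Omega P)| <=
      C * `|P - Q| `^ (1 + alpha).
Proof.
move=> a0 kF.
pose good (C : R) P := frontier Omega P -> forall Q, frontier Omega Q ->
    `|dot (P - Q) (exterior_normal alpha Omega P)| <=
      C * `|P - Q| `^ (1 + alpha).
have /compact_near_coveringP cov := kF.
have [C [Creal hC]] : \forall C \near +oo%R, frontier Omega `<=` good C.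
  apply: cov => P0 fP0.
  have [r [C0 [r0 C00 near_P0]]] := lyapunov_near P0 a0 fP0.
  have r2 : 0 < r / 2 by lra.
  pose C1 := Num.max C0 (3 * (r / 2) `^ (- alpha)).
  exists (ball P0 (r / 2), [set C | C1 <= C]).
    split; first exact: nbhsx_ballx.
    by exists C1; split; [exact: num_real|move=> ? /ltW].
  move=> [P C] [/= + C1C] fP Q fQ; rewrite mx_norm_ball /ball_/= => P0P.
  have [PQ|PQ] := ltP `|P - Q| (r / 2).
    apply: le_trans (near_P0 P Q fP fQ _ _) _; first by lra.
      by have := ler_distD P P0 Q; lra.
    apply: ler_wpM2r; first exact: powR_ge0.
    by apply: le_trans C1C; rewrite le_max lexx.
  have PQ0 : 0 < `|P - Q| by exact: lt_le_trans r2 PQ.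
  apply: (@le_trans _ _ (3 * `|P - Q|)).
    have := dot_le (P - Q) _ _ (fun j => exterior_normal_le1 P j fP).
    by rewrite mulr1.
  rewrite powRD; last by rewrite (gt_eqF PQ0) implybT.
  rewrite powRr1// mulrCA [3 * _]mulrC; apply: ler_wpM2l => //.
  rewrite -ler_pdivrMr ?powR_gt0// -powRN.
  apply: le_trans C1C; rewrite le_max; apply/orP; right; apply: ler_wpM2l => //.
  rewrite !powRN lef_pV2 ?posrE ?powR_gt0//.
  by apply: ge0_ler_powR; rewrite ?nnegrE// ltW.
have [C0 h0] : exists C0, C < C0 /\ 0 <= C0.
  by exists (Num.max C 0 + 1); case: (leP C 0); lra.
exists C0; first exact: h0.2.
by move=> P Q fP fQ; exact: (hC C0 h0.1 P fP fP Q fQ).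
Qed.
End Boundary.
End ExteriorNormal.

(** * Measure of balls on the surface *)

Section SurfaceMeasure.
Context {R : realType}.
Implicit Types (c : @graph_chart R) (P M : 'rV[R]_3).

Lemma continuous_measurable_borel (f : 'rV[R]_3 -> R) :
  continuous f -> measurable_fun [set: borel3 R] (f : borel3 R -> R).
Proof.
move=> cf; apply: (measurability _ (RGenOpens.measurableE R)).
move=> _ [_ [a [b ->] <-]]; rewrite setTI; apply: sub_gen_smallest.
by apply: open_comp => [x _|]; [exact: cf|exact: interval_open].
Qed.

Lemma continuous_dist M : continuous (fun P => `|P - M|).
Proof.
move=> P; have FP : Filter (nbhs P) by exact: nbhs_filter.
by apply: cvg_norm; apply: cvgB; [exact: cvg_id|exact: cvg_cst].
Qed.

Lemma frontier_bounded (Omega : set 'rV[R]_3) : bounded_set Omega ->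
  exists2 b : R, 0 <= b & forall P, frontier Omega P -> `|P| <= b.
Proof.
move=> [b [_ hb]]; exists (Num.max b 0 + 1) => [|P [clP _]].
  by rewrite addr_ge0 ?le_max ?lexx ?orbT.
have clB : closed [set Q : 'rV[R]_3 | `|Q| <= Num.max b 0 + 1].
  apply: (@preimage_closed _ _ (fun Q : 'rV[R]_3 => `|Q|)
    [set y | y <= Num.max b 0 + 1]) => [Q _|]; first exact: norm_continuous.
  exact: closed_le.
apply: clB; apply: closureS clP => Q OQ; apply: hb OQ.
by case: (leP b 0); lra.
Qed.

Lemma frontier_closed (Omega : set 'rV[R]_3) : closed (frontier Omega).
Proof.
rewrite /frontier setDE; apply: closedI; first exact: closed_closure.
exact/open_closedC/open_interior.
Qed.

Lemma frontier_compact (Omega : set 'rV[R]_3) : bounded_set Omega ->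
  compact (frontier Omega).
Proof.
move=> /frontier_bounded[b b0 hb].
apply: bounded_closed_compact; last exact: frontier_closed.
exists b; split; first exact: num_real.
by move=> x bx P /hb Pb; exact: le_trans Pb (ltW bx).
Qed.

Lemma area_density_le c u :
  area_density c u <=
    1 + (`|partial 0 (height c) u| + `|partial 1 (height c) u|).
Proof.
rewrite /area_density !big_ord_recl big_ord0 addr0.
rewrite (_ : lift ord0 ord0 = 1 :> 'I_2); last exact: val_inj.
rewrite -[leRHS]ger0_norm ?addr_ge0// -sqrtr_sqr ler_wsqrtr//.
rewrite -(real_normK (num_real (partial ord0 _ _))).
rewrite -(real_normK (num_real (partial 1 _ _))).
by have := normr_ge0 (partial 0 (height c) u);
  have := normr_ge0 (partial 1 (height c) u); nra.
Qed.

Section Chart.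
Variables (alpha : R) (Omega : set 'rV[R]_3) (c : @graph_chart R).
Hypotheses (alpha0 : 0 < alpha) (cc : is_graph_chart alpha Omega c).

(** The base need not be connected, and the Hoelder condition relates all pairs
    of its points: comparison with one point u0 over S bounds the gradient on
    the bounded set of the points over S. *)
Lemma area_density_bounded (S : set 'rV[R]_3) (b : R) :
  S `<=` nbhd c -> (forall P, S P -> `|P| <= b) ->
  exists2 L : R, 0 <= L &
    forall u, S (graph_point c u) -> area_density c u <= L.
Proof.
move=> Sn Sb; have [[u0 Su0]|none] := pselect (exists u, S (graph_point c u));
  last by exists 0 => // u Su; case: none; exists u.
have [_ _ [_ [C hC]] nb _] := cc.
have inbase u : S (graph_point c u) -> base c u.
  by move=> /Sn/nb; rewrite shadow_graph_point.
have ub u : S (graph_point c u) -> `|u| <= b.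
  move=> Su; apply: le_trans (Sb _ Su).
  by rewrite -{1}(shadow_graph_point c u) shadow_norm_le.
pose D := Num.max C 0 * (b + b) `^ alpha.
have bound (k : 'I_2) u : S (graph_point c u) ->
    `|partial k (height c) u| <= `|partial k (height c) u0| + D.
  move=> Su; rewrite -lerBlDl; apply: le_trans (lerB_dist _ _) _.
  apply: le_trans (hC k _ _ (inbase _ Su) (inbase _ Su0)) _.
  apply: (@le_trans _ _ (Num.max C 0 * `|u - u0| `^ alpha)).
    by apply: ler_wpM2r; [exact: powR_ge0|rewrite le_max lexx].
  apply: ler_wpM2l; first by rewrite le_max lexx orbT.
  apply: ge0_ler_powR; rewrite ?nnegrE ?(ltW alpha0)//.
    by apply: addr_ge0; apply: le_trans (ub _ Su0); exact: normr_ge0.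
  by apply: le_trans (ler_normB _ _) _; apply: lerD; exact: ub.
exists (1 + (`|partial 0 (height c) u0| + D +
  (`|partial 1 (height c) u0| + D))).
  have D0 : 0 <= D by rewrite mulr_ge0 ?powR_ge0// le_max lexx orbT.
  by rewrite !addr_ge0.
move=> u Su; apply: le_trans (area_density_le c u) _.
by rewrite lerD2l; apply: lerD; exact: bound.
Qed.

(** The projection along the axis is 1-Lipschitz for the sup norm, so the part
    of the graph in the ball around M lies over the square of side 2 r around
    the projection of M, wherever M is. *)
Lemma graph_area_le (A E : set (borel3 R)) (L r : R) M :
  measurable A -> measurable E -> E `<=` nbhd c -> 0 <= L -> 0 <= r ->
  (forall u, E (graph_point c u) -> area_density c u <= L) ->
  (forall P, A P -> `|P - M| <= r) ->
  (graph_area c (A `&` E) <= (L * (4 * r ^+ 2))%:E)%E.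
Proof.
move=> mA mE En L0 r0 hL hA; rewrite /graph_area; set D := _ @^-1` _.
have mD : measurable D.
  by apply: (preim_measurable cc); [exact: measurableI|move=> P [_ /En]].
pose box : set (R * R) :=
  `[(shadow c M).1 - r, (shadow c M).1 + r]%classic `*`
  `[(shadow c M).2 - r, (shadow c M).2 + r]%classic.
have mbox : measurable box by apply: measurableX; exact: measurable_itv.
have Dbox : D `<=` box.
  move=> u [/hA Pr _].
  have h k := le_trans (coord_le_norm (graph_point c u - M) (lift (axis c) k)) Pr.
  have := h 0; have := h 1; rewrite !mxE !liftK /= !ler_norml.
  move=> /andP[? ?] /andP[? ?].
  by split; rewrite /= in_itv/=; apply/andP; split; lra.
apply: (@le_trans _ _
  (\int[lebesgue_measure \x lebesgue_measure]_(u in D) (cst L%:E u))%E).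
  apply: ge0_le_integral_nonmeasurable => u Du.
    by rewrite lee_fin sqrtr_ge0.
  by rewrite lee_fin; apply: hL; case: Du.
rewrite integral_cst// EFinM; apply: lee_wpmul2l; first by rewrite lee_fin.
apply: (@le_trans _ _ ((lebesgue_measure \x lebesgue_measure)%E box)).
  by apply: le_measure; rewrite ?inE.
rewrite product_measure1E; [|exact: measurable_itv..].
have li (a : R) : lebesgue_measure `[a - r, a + r]%classic = (2 * r)%:E.
  rewrite lebesgue_measure_itv/= lte_fin; case: ifPn => ?.
    by rewrite -EFinB; congr EFin; ring.
  by rewrite (_ : r = 0) ?mulr0//; lra.
rewrite /= !li -EFinM lee_fin.
by nra.
Qed.
End Chart.

Lemma surface_measure_regular alpha (Omega : set 'rV[R]_3)
    (sigma : {measure set (borel3 R) -> \bar R}) :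
  0 < alpha -> bounded_set Omega -> is_surface_measure alpha Omega sigma ->
  exists2 K : R, 0 <= K & forall M (r : R) (A : set (borel3 R)), 0 <= r ->
    measurable A -> (forall P, A P -> `|P - M| <= r) ->
    (sigma A <= (K * r ^+ 2)%:E)%E.
Proof.
move=> alpha0 bO [n [c [E [cc mE _ UE sE]]]].
have [b b0 hb] := frontier_bounded _ bO.
have /choice[L hL] : forall k, exists L : R, 0 <= L /\
    forall u, E k (graph_point (c k) u) -> area_density (c k) u <= L.
  move=> k.
  have [||L L0 hL] :=
    area_density_bounded alpha Omega (c k) alpha0 (cc k) (E k) b.
  - by have [] := mE k.
  - by move=> P EP; apply: hb; rewrite -UE; exists k.
  by exists L.
exists (\sum_(k < n) L k * 4).
  by apply: sumr_ge0 => k _; rewrite mulr_ge0 ?(hL k).1.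
move=> M r A r0 mA Ar; rewrite sE// mulr_suml -sumEFin.
apply: lee_sum => k _; have [mEk Ek] := mE k; have [Lk0 hLk] := hL k.
rewrite -mulrA.
exact: (graph_area_le _ _ _ (cc k) _ _ _ _ M mA mEk Ek Lk0 r0 hLk Ar).
Qed.
End SurfaceMeasure.

(** * Bound of the double layer potential *)

Section DoubleLayer.
Context {R : realType}.
Variables (alpha : R) (Omega : set 'rV[R]_3).
Hypothesis HO : C1_holder_boundary alpha Omega.

(** Splitting P - M = (P - Q) + (Q - M): the first part is controlled by
    tangency, with |P - Q| <= 2 |P - M|, and the second one by |Q - M| as the
    normal is bounded.  The term |Q - M| |P - M|^(-3) is a multiple of the
    Poisson kernel of the tangent plane. *)
Lemma kernel_le (C : R) (P Q M : 'rV[R]_3) : 0 <= alpha -> 0 <= C ->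
  frontier Omega P -> `|Q - M| <= `|P - M| ->
  `|dot (P - Q) (exterior_normal alpha Omega P)| <=
    C * `|P - Q| `^ (1 + alpha) ->
  `|dot (P - M) (exterior_normal alpha Omega P)| / enorm (P - M) ^+ 3 <=
    3 * (`|Q - M| * `|P - M| `^ (- 3)) +
    C * 2 `^ (1 + alpha) * `|P - M| `^ (alpha - 2).
Proof.
move=> a0 C0 fP QM hC.
have dotD (u v w : 'rV[R]_3) : dot (u + v) w = dot u w + dot v w.
  by rewrite /dot -big_split; apply: eq_bigr => i _; rewrite mxE mulrDl.
have [PM|PM] := eqVneq (P - M) 0.
  have dot0 (w : 'rV[R]_3) : dot 0 w = 0.
    by rewrite /dot big1// => i _; rewrite mxE mul0r.
  rewrite PM dot0 normr0 mul0r; apply: addr_ge0.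
    apply: mulr_ge0; [exact: ler0n|apply: mulr_ge0; [exact: normr_ge0|]].
    exact: powR_ge0.
  apply: mulr_ge0; [apply: mulr_ge0; [exact: C0|]|]; exact: powR_ge0.
have s0 : 0 < `|P - M| by rewrite normr_gt0.
have PQ : `|P - Q| <= 2 * `|P - M|.
  by have := ler_distD M P Q; rewrite (distrC M Q); lra.
apply: (@le_trans _ _
  (`|dot (P - M) (exterior_normal alpha Omega P)| / `|P - M| ^+ 3)).
  apply: ler_wpM2l => //; rewrite lef_pV2 ?posrE ?exprn_gt0//.
    by apply: lerXn2r; rewrite ?nnegrE ?sqrtr_ge0 ?norm_le_enorm.
  exact: lt_le_trans s0 (norm_le_enorm _).
apply: ler_div_cube => //.
rewrite -[X in dot X _](subrKA Q) dotD addrC.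
apply: le_trans (ler_normD _ _) _; apply: lerD.
  have := dot_le (Q - M) _ _ (fun j => exterior_normal_le1 _ _ HO P j fP).
  by rewrite mulr1.
apply: le_trans hC _; rewrite -mulrA; apply: ler_wpM2l => //.
rewrite -powRM//.
by apply: ge0_ler_powR; rewrite ?nnegrE ?addr_ge0 ?mulr_ge0.
Qed.
End DoubleLayer.

Theorem theorem2p2 (R : realType) (alpha : R) (Omega : set 'rV[R]_3)
    (sigma : {measure set (borel3 R) -> \bar R}) :
  0 < alpha <= 1 ->
  bounded_domain Omega ->
  C1_holder_boundary alpha Omega ->
  is_surface_measure alpha Omega sigma ->
  (ereal_sup [set \int[sigma]_(P in frontier Omega)
                    (`|dot (P - M) (exterior_normal alpha Omega P)| /
                     enorm (P - M) ^+ 3)%:E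
             | M in [set: 'rV[R]_3]] < +oo)%E.
Proof.
move=> a01 [_ _ _ bO] HO Hs; have /andP[a0 a1] := a01.
have kF := frontier_compact _ bO.
have [C C0 hC] := lyapunov _ _ HO (ltW a0) kF.
have [K K0 hK] := surface_measure_regular _ _ _ a0 bO Hs.
have [b b0 hb] := frontier_bounded _ bO.
have mF : measurable (frontier Omega : set (borel3 R)).
  rewrite -[frontier _]setCK; apply: measurableC; apply: sub_gen_smallest.
  exact/closed_openC/frontier_closed.
pose C' := C * 2 `^ (1 + alpha).
have C'0 : 0 <= C' by rewrite mulr_ge0 ?powR_ge0.
pose B1 : R := 8 * K.
pose B2 : R := (K * b ^+ 2 + 4 * K) / (1 - 2^-1 `^ alpha).
apply: (@le_lt_trans _ _ (3 * B1 + C' * B2)%:E); last exact: ltry.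
apply: ge_ereal_sup => _ [M _ <-].
pose s (P : borel3 R) : R := `|(P : 'rV[R]_3) - M|.
have ms : measurable_fun [set: borel3 R] s.
  by apply: continuous_measurable_borel; exact: continuous_dist.
have [Q nearest] : exists Q, forall P, frontier Omega P ->
    frontier Omega Q /\ `|Q - M| <= s P.
  have [F0|/set0P F0] := eqVneq (frontier Omega) set0.
    (* When the boundary is empty, every Q will do. *)
    by exists 0 => P; rewrite F0.
  have [Q /set_mem fQ QM] := compact_EVT_min F0 kF
    (continuous_subspaceT (continuous_dist M)).
  by exists Q => P fP; split=> //; exact/QM/mem_set.
have mp p : measurable_fun (frontier Omega : set (borel3 R)) (fun P => s P `^ p).
  apply: measurable_funTS.
  exact: measurableT_comp (measurable_powR p) ms.
have reg r : 0 <= r ->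
    (sigma ([set P | (s P <= r)%R] `&` frontier Omega) <= (K * r ^+ 2)%:E)%E.
  move=> r0; apply: (hK M) => //; last by move=> P [].
  by apply: measurableI mF; exact: measurable_sublevel ms.
have near : (\int[sigma]_(P in frontier Omega)
    (s P `^ (alpha - 2))%:E <= B2%:E)%E.
  apply: integral_near_le => //; first by move=> P; exact: normr_ge0.
  by apply: (hK 0) => // P /hb; rewrite subr0.
have far : (\int[sigma]_(P in frontier Omega)
    (`|Q - M| * s P `^ (- 3))%:E <= B1%:E)%E.
  by apply: integral_far_le => // P /nearest[].
apply: (@le_trans _ _ (\int[sigma]_(P in frontier Omega)
   (3%:E * (`|Q - M| * s P `^ (- 3))%:E + C'%:E * (s P `^ (alpha - 2))%:E))%E).
  apply: ge0_le_integral_nonmeasurable => P fP.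
    by rewrite lee_fin divr_ge0// exprn_ge0// sqrtr_ge0.
  rewrite -!EFinM -EFinD lee_fin.
  have [fQ QM] := nearest _ fP.
  by apply: kernel_le => //; [exact: ltW|exact: hC].
have mfar : measurable_fun (frontier Omega : set (borel3 R))
    (fun P => (`|Q - M| * s P `^ (- 3))%:E).
  by apply: measurableT_comp => //; exact: measurable_funM.
have mnear : measurable_fun (frontier Omega : set (borel3 R))
    (fun P => (s P `^ (alpha - 2))%:E).
  exact: measurableT_comp.
have far0 P : (0 <= (`|Q - M| * s P `^ (- 3))%:E)%E.
  by rewrite lee_fin mulr_ge0 ?powR_ge0.
have near0 P : (0 <= (s P `^ (alpha - 2))%:E)%E by rewrite lee_fin powR_ge0.
have c3 : (0 <= 3%:E :> \bar R)%E by rewrite lee_fin.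
have cC' : (0 <= C'%:E)%E by rewrite lee_fin.
rewrite ge0_integralD//; last 4 first.
- by move=> P _; exact: mule_ge0.
- exact: measurable_funeM.
- by move=> P _; exact: mule_ge0.
- exact: measurable_funeM.
rewrite !ge0_integralZl//.
exact: (le_trans (leeD (lee_wpmul2l c3 far) (lee_wpmul2l cC' near))).
Qed.
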